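(* Let $\tau$ be an rp-tree with $n$ leaves and $f_\tau$ the operad structure map for the morphism from $\tau$ to the corresponding corolla. Let $B_{v_i}$ be bracket expressions in $|v_i|$ variables, where $v_i$ ranges over the internal vertices of $\tau$. Let $D\in\Delta_n$ or $D\in o\Delta_n$. Then $$\Big\langle D,\ f_\tau\big(\textstyle\bigotimes B_{v_i}\big)\Big\rangle=\Big\langle g_\tau(D),\ \textstyle\bigotimes B_{v_i}\Big\rangle_\otimes,$$ where $\langle\cdot,\cdot\rangle_\otimes$ denotes the tensor product of the even configuration pairings if $D\in\Delta_n$ (respectively of the odd configuration pairings if $D\in o\Delta_n$), and $f_\tau,g_\tau$ are the corresponding even (respectively odd) structure maps.
   Context: Fix a commutative ground ring $R$; write $\mathbf n=\{1,\dots,n\}$. Diagrams. A Diagram is a finite, possibly disconnected, oriented graph with vertices labeled bijectively by $\mathbf n$; an oDiagram is a finite, possibly disconnected, unoriented graph with vertices labeled bijectively by $\mathbf n$ and a total ordering of its edges. Each edge joins distinct vertices; multiple edges are allowed. $\Delta_n$ and $o\Delta_n$ are the free $R$-modules on Diagrams and oDiagrams. Bracket expressions. A bracket expression in $m$ variables is an expression in $x_1,\dots,x_m$, using each variable exactly once, built from two binary multiplications $[\,,]$ and $\cdot$. Configuration pairings with bracket expressions. For a Diagram or oDiagram $D$ and a bracket expression $B$, $\beta_{D,B}$ sends an edge between $i$ and $j$ to the innermost pair of brackets of $B$ containing both $x_i$ and $x_j$; $\beta_{D,B}$ is not defined if for some edge no such pair of brackets exists, or if $x_i$ and $x_j$ are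 multiplied by $\cdot$ internal to any brackets (i.e. the smallest sub-expression containing both is of the form $Y\cdot Z$, with one variable in $Y$ and the other in $Z$). Set $\langle D,B\rangle=0$ if $\beta_{D,B}$ is not defined or is not a bijection between the edges of $D$ and the bracket pairs of $B$. Otherwise, in the even case $\langle D,B\rangle=(-1)^k$, where $k$ is the number of edges $i\to j$ of $D$ for which $x_j$ is to the left of $x_i$ in $B$; in the odd case $\langle D,B\rangle$ is the sign of the permutation given by $\beta_{D,B}$ between the ordered set of edges of $D$ and the bracket pairs of $B$ ordered from left to right (by the position of their commas). Extend bilinearly. rp-trees. An rp-tree is a rooted planar tree in the upper half-plane with a root edge, whose internal vertices may have any positive number of branches; for an internal vertex $v$, $|v|$ is its valence minus one, i.e. its number of branches. Label the leaves of $\tau$ by $1,\dots,n$ and the branches of each internal vertex $v$ by $1,\dots,|v|$, from left to right. Fix an ordering of the internal vertices of $\tau$, used in all tensor products. The map $f_\tau$. It is the iterated substitution: for each internal vertex $v$ let $E_v$ be obtained from $B_v$ by substituting for $x_k$ the variable $x_\ell$ if the $k$th branch of $v$ ends in the leaf of $\tau$ labeled $\ell$, and the expression $E_w$ if the $k$th branch of $v$ ends in the internal vertex $w$. Let $E$ be the expression $E_v$ for $v$ the internal vertex on the root edge; it is a bracket expression in $x_1,\dots,x_n$. In the even case $f_\tau(\bigotimes B_{v_i})=E$; in the odd case $f_\tau(\bigotimes B_{v_i})=\mathrm{sign}(\rho)E$, where $\rho$ is the permutation relating the order of bracket pairs as they occur in $\bigotimes B_{v_i}$ (concatenating factors) to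 the left-to-right order of the corresponding bracket pairs of $E$. The map $g_\tau$. For distinct $j,k\in\mathbf n$ let $v$ be the nadir (vertex closest to the root) of the shortest path in $\tau$ between leaves $j$ and $k$, and let $J_v(j),J_v(k)$ be the labels of the branches of $v$ over which leaves $j$ and $k$ lie. $D_v$ is the graph on vertices $\{1,\dots,|v|\}$ having, for each edge of $D$ between $j$ and $k$ whose associated nadir is $v$, an edge between $J_v(j)$ and $J_v(k)$ (oriented from $J_v(j)$ to $J_v(k)$ if the edge is $j\to k$; respectively, with edges ordered as the edges of $D$ giving rise to them). In the even case $g_\tau(D)=\bigotimes_{v_i}D_{v_i}$; in the odd case $g_\tau(D)=\mathrm{sign}(\pi)\bigotimes_{v_i}D_{v_i}$, where $\pi$ is the permutation relating the order of all edges in $\bigotimes_{v_i}D_{v_i}$ (concatenating factors) to their order within $D$. Extend linearly. *)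

(* Defs.v *)
From HB Require Import structures.
From mathcomp Require Import all_boot all_order all_algebra all_fingroup.
From mathcomp Require Import finmap multiset freeg.

Set Implicit Arguments.
Unset Strict Implicit.
Unset Printing Implicit Defensive.

Import GRing.Theory.
Local Open Scope ring_scope.
Local Open Scope mset_scope.

(** * Linear algebra

    The free R-module on a basis K is [{freeg K / R}]; [<<x>>] is the basis
    element given by x : K, and [fglift f] is the linear extension of f. *)

Section LinearExtension.
Variables (R : comNzRingType) (K K' : choiceType).

Definition bilinear_ext (p : K -> K' -> R)
    (x : {freeg K / R}) (y : {freeg K' / R}) : R :=
  fglift (fun k => fglift (fun k' => p k k' : R^o) y : R^o) x.

End LinearExtension.

(** The tensor product of the free modules on bases K v, v in a finite set I,
    is the free module on the product of the K v; the family x corresponds to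
    the pure tensor whose v-th factor is the basis element x v. *)

Section Tensor.
Variables (R : comNzRingType) (I : finType).

Definition tensor (K : I -> choiceType) : lmodType R :=
  {freeg {dffun forall v : I, K v} / R}.

Definition pure_tensor (K : I -> choiceType) (x : forall v, K v) : tensor K :=
  << [ffun v => x v] : {dffun forall v : I, K v} >>.

Definition tensor_pairing (K K' : I -> choiceType)
    (p : forall v, K v -> K' v -> R) (x : tensor K) (y : tensor K') : R :=
  bilinear_ext (fun (k : {dffun forall v, K v}) (k' : {dffun forall v, K' v}) =>
                  \prod_v p v (k v) (k' v)) x y.

End Tensor.

(** The permutation p with s_i = t_(p i), when t is a rearrangement of a
    duplicate-free list s. *)

Definition relating_perm (T : eqType) (s t : seq T) : 'S_(size s) :=
  odflt 1%g [pick p : 'S_(size s) |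
               [forall i : 'I_(size s), onth s i == onth t (p i)]].

Definition sign (T : eqType) (s t : seq T) (R : comNzRingType) : R :=
  (-1) ^+ odd_perm (relating_perm s t).

(** * Diagrams

    Vertices are indexed by 'I_n = {0, .., n-1} instead of {1, .., n}. *)

Record arrow (n : nat) := Arrow {
  arrow_ends :> 'I_n * 'I_n;
  _ : arrow_ends.1 != arrow_ends.2 }.
HB.instance Definition _ n := [isSub for @arrow_ends n].
HB.instance Definition _ n := [Choice of arrow n by <:].

(** An unoriented edge, stored as the pair of its end points in increasing
    order. *)
Record edge (n : nat) := Edge {
  edge_ends :> 'I_n * 'I_n;
  _ : (edge_ends.1 < edge_ends.2)%N }.
HB.instance Definition _ n := [isSub for @edge_ends n].
HB.instance Definition _ n := [Choice of edge n by <:].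

Definition mk_arrow n (i j : 'I_n) : option (arrow n) := insub (i, j).
Definition mk_edge n (i j : 'I_n) : option (edge n) :=
  if (i < j)%N then insub (i, j) else insub (j, i).

(** Up to isomorphism fixing the labels, a Diagram is the finite multiset of its
    arrows, and an oDiagram is the list of its edges in their given order. *)
Definition diagram (n : nat) : choiceType := {mset arrow n}.
Definition odiagram (n : nat) : choiceType := seq (edge n).

Notation Delta R n := {freeg (diagram n) / R}.
Notation oDelta R n := {freeg (odiagram n) / R}.

(** * Bracket expressions *)

Inductive expr (T : Type) : Type :=
  | Var of T
  | Bra of expr T & expr T      (* [Y, Z] *)
  | Dot of expr T & expr T.     (* Y . Z *)

Section ExprChoice.
Variable T : Type.

Fixpoint expr_code (e : expr T) : GenTree.tree T :=
  match e with
  | Var x => GenTree.Leaf x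
  | Bra y z => GenTree.Node 0 [:: expr_code y; expr_code z]
  | Dot y z => GenTree.Node 1 [:: expr_code y; expr_code z]
  end.

Fixpoint expr_decode (c : GenTree.tree T) : option (expr T) :=
  match c with
  | GenTree.Leaf x => Some (Var x)
  | GenTree.Node 0 [:: c1; c2] =>
      if expr_decode c1 is Some y then omap (Bra y) (expr_decode c2) else None
  | GenTree.Node 1 [:: c1; c2] =>
      if expr_decode c1 is Some y then omap (Dot y) (expr_decode c2) else None
  | _ => None
  end.

Lemma expr_codeK : pcancel expr_code expr_decode.
Proof. by elim=> //= y -> z ->. Qed.

End ExprChoice.

HB.instance Definition _ (T : eqType) :=
  Equality.copy (expr T) (pcan_type (@expr_codeK T)).
HB.instance Definition _ (T : choiceType) :=
  Choice.copy (expr T) (pcan_type (@expr_codeK T)).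

(** The variables of e, from left to right. *)
Fixpoint vars (T : Type) (e : expr T) : seq T :=
  match e with
  | Var x => [:: x]
  | Bra y z | Dot y z => vars y ++ vars z
  end.

Fixpoint subst (S T : Type) (s : S -> expr T) (e : expr S) : expr T :=
  match e with
  | Var x => s x
  | Bra y z => Bra (subst s y) (subst s z)
  | Dot y z => Dot (subst s y) (subst s z)
  end.

Definition rename (S T : Type) (f : S -> T) : expr S -> expr T :=
  subst (fun x => Var (f x)).

Record bexpr (m : nat) := BExpr {
  bexpr_val :> expr 'I_m;
  _ : perm_eq (vars bexpr_val) (enum 'I_m) }.
HB.instance Definition _ m := [isSub for @bexpr_val m].
HB.instance Definition _ m := [Choice of bexpr m by <:].

(** A sub-expression is identified by its position: the list of left (false)
    and right (true) turns leading to it from the whole expression. *)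
Notation position := (seq bool).

(** The positions of the bracket pairs, ordered from left to right by commas. *)
Fixpoint brackets (T : Type) (e : expr T) : seq position :=
  match e with
  | Var _ => [::]
  | Bra y z => map (cons false) (brackets y)
               ++ [::] :: map (cons true) (brackets z)
  | Dot y z => map (cons false) (brackets y) ++ map (cons true) (brackets z)
  end.

Section Positions.
Variable T : eqType.
Implicit Types (e : expr T) (i j : T).

Fixpoint var_position e i : position :=
  match e with
  | Var _ => [::]
  | Bra y z | Dot y z =>
      if i \in vars y then false :: var_position y i
      else true :: var_position z i
  end.

Definition left_of e i j : bool := (index i (vars e) < index j (vars e))%N.

(** The innermost pair of brackets of e containing both i and j. *)
Fixpoint innermost e i j : option position :=
  match e with
  | Var _ => None
  | Bra y z =>
      match innermost y i j, innermost z i j with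
      | Some p, _ => Some (false :: p)
      | None, Some p => Some (true :: p)
      | None, None =>
          if (i \in vars e) && (j \in vars e) then Some [::] else None
      end
  | Dot y z =>
      match innermost y i j, innermost z i j with
      | Some p, _ => Some (false :: p)
      | None, Some p => Some (true :: p)
      | None, None => None
      end
  end.

(** e has a sub-expression Y . Z with one of i, j in Y and the other in Z. *)
Fixpoint dotted e i j : bool :=
  match e with
  | Var _ => false
  | Bra y z => dotted y i j || dotted z i j
  | Dot y z => [|| dotted y i j, dotted z i j,
                   (i \in vars y) && (j \in vars z) |
                   (j \in vars y) && (i \in vars z)]
  end.

Definition beta e i j : option position :=
  if dotted e i j then None else innermost e i j.

End Positions.

(** * Configuration pairings

    In both cases the test [perm_eq (_ : seq (option position)) _] says that
    beta is defined on every edge and that every bracket pair is the image of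
    exactly one edge (the list of bracket pairs has no repetition). *)

Section Pairings.
Variables (R : comNzRingType) (n : nat).

Definition even_pair (d : diagram n) (b : bexpr n) : R :=
  if perm_eq [seq beta b a.1 a.2 | a : arrow n <- enum_mset d]
             (map Some (brackets b))
  then (-1) ^+ count (fun a : arrow n => left_of b a.2 a.1) (enum_mset d)
  else 0.

Definition odd_pair (d : odiagram n) (b : bexpr n) : R :=
  let images := [seq beta b a.1 a.2 | a : edge n <- d] in
  let targets := map Some (brackets b) in
  if perm_eq images targets then sign images targets R else 0.

Definition even_pairing : Delta R n -> {freeg (bexpr n) / R} -> R :=
  bilinear_ext even_pair.

Definition odd_pairing : oDelta R n -> {freeg (bexpr n) / R} -> R :=
  bilinear_ext odd_pair.

End Pairings.

(** * rp-trees

    [Node k ch] has k+1 branches, labeled from left to right by 'I_k.+1; the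
    tree above the root edge is either a single leaf or an internal vertex. *)

Inductive rptree : Type :=
  | Leaf
  | Node (k : nat) (ch : 'I_k.+1 -> rptree).

Fixpoint leaf (t : rptree) : finType :=
  match t with
  | Leaf => unit
  | Node k ch => {i : 'I_k.+1 & leaf (ch i)}
  end.

(** The internal vertices; [None] is the one on the root edge. *)
Fixpoint vertex (t : rptree) : finType :=
  match t with
  | Leaf => void
  | Node k ch => option {i : 'I_k.+1 & vertex (ch i)}
  end.

(** The number |v| of branches of an internal vertex. *)
Fixpoint arity (t : rptree) : vertex t -> nat :=
  match t return vertex t -> nat with
  | Leaf => fun=> 0
  | Node k ch => fun v => if v is Some u then arity (tagged u) else k.+1
  end.

(** The leaves and the internal vertices lying on the i-th branch of the root
    vertex. *)
Definition leaf_on k (ch : 'I_k.+1 -> rptree) i (l : leaf (ch i)) :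
    leaf (Node ch) :=
  existT (fun j => leaf (ch j)) i l.
Definition vertex_on k (ch : 'I_k.+1 -> rptree) i (v : vertex (ch i)) :
    vertex (Node ch) :=
  Some (existT (fun j => vertex (ch j)) i v).

Notation nleaves t := #|leaf t|.

(** The leaves are labeled by [enum_rank : leaf t -> 'I_(nleaves t)], which is
    the labeling from left to right by the following fact. *)
Lemma enum_leaf_Node k (ch : 'I_k.+1 -> rptree) :
  enum (leaf (Node ch)) =
  [seq leaf_on l | i <- enum 'I_k.+1, l <- enum (leaf (ch i))].
Proof.
rewrite /= enumT unlock /= /tag_enum; congr flatten; rewrite -enumT.
by apply: eq_map => i; rewrite enumT.
Qed.

(** The label J_v(l) of the branch of v over which l lies; [None] if l does not
    lie over v. *)
Fixpoint branch (t : rptree) :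
    forall v : vertex t, leaf t -> option 'I_(arity v) :=
  match t return forall v : vertex t, leaf t -> option 'I_(arity v) with
  | Leaf => fun v => match v with end
  | Node k ch => fun v =>
      match v return leaf (Node ch) -> option 'I_(@arity (Node ch) v) with
      | None => fun l => Some (tag l)
      | Some u => untag None (branch (tagged u))
      end
  end.

(** The internal vertices on the path from the root to a leaf, in this order. *)
Fixpoint root_path (t : rptree) : leaf t -> seq (vertex t) :=
  match t return leaf t -> seq (vertex t) with
  | Leaf => fun=> [::]
  | Node k ch => fun l =>
      None :: [seq vertex_on u | u <- root_path (tagged l)]
  end.

(** The shortest path between two distinct leaves goes down to the last common
    vertex of their paths from the root, and up again: that vertex is its nadir. *)
Definition nadir (t : rptree) (l m : leaf t) : option (vertex t) :=
  last None [seq Some v | v <- root_path l & v \in root_path m].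

Lemma vertex_on_inj k (ch : 'I_k.+1 -> rptree) i : injective (@vertex_on k ch i).
Proof. by move=> u v [] /eqP; rewrite -tag_eqE /tag_eq /= eqxx tagged_asE => /eqP. Qed.

Lemma nadir_same k (ch : 'I_k.+1 -> rptree) i (l m : leaf (ch i)) :
  nadir (leaf_on l) (leaf_on m) =
  Some (odflt None (omap (@vertex_on k ch i) (nadir l m))).
Proof.
rewrite /nadir /= filter_map.
set r := [seq u <- root_path l | _].
have -> : r = [seq u <- root_path l | u \in root_path m].
  apply: eq_filter => v /=.
  by rewrite in_cons /= mem_map //; apply: vertex_on_inj.
by case: [seq _ <- _ | _] => //= u s; elim: s u => //= w s IH u.
Qed.

Lemma nadir_diff k (ch : 'I_k.+1 -> rptree) i j (l : leaf (ch i)) (m : leaf (ch j)) :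
  i != j -> nadir (leaf_on l) (leaf_on m) = Some None.
Proof.
move=> nij; rewrite /nadir /=.
rewrite (_ : [seq _ <- _ | _] = [::]) //.
apply/eqP; rewrite -[_ == _]negbK -has_filter; apply/hasPn => v /mapP[u _ ->].
rewrite in_cons /=; apply/mapP => -[w _ []] E _; by rewrite E eqxx in nij.
Qed.

Lemma branch_on k (ch : 'I_k.+1 -> rptree) i (u : vertex (ch i))
    (l : leaf (ch i)) :
  branch (vertex_on u) (leaf_on l) = branch u l.
Proof.
exact: (untagE None (branch u) (u := existT (fun j => leaf (ch j)) i l)
          (erefl i)).
Qed.

(** The nadir is the vertex over which the two leaves lie on distinct branches. *)
Lemma nadirP (t : rptree) (l m : leaf t) : l != m ->
  exists v a b, [/\ nadir l m = Some v, branch v l = Some a,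
                   branch v m = Some b & a != b].
Proof.
elim: t l m => [|k ch IH]; first by case; case.
move=> [i l] [j m]; case: (eqVneq i j) => [E|nij]; last first.
  by exists None, i, j; split=> //; apply: nadir_diff.
subst j => nlm.
have /IH[v [a [b [nd bl bm nab]]]] : l != m.
  by apply: contraNneq nlm => ->.
exists (vertex_on v), a, b; split=> //; last 2 first.
- exact: etrans (branch_on _ _) _.
- exact: etrans (branch_on _ _) _.
by have := nadir_same l m; rewrite nd.
Qed.

(** * The map f *)

Fixpoint composite (t : rptree) :
    (forall v : vertex t, bexpr (arity v)) -> expr (leaf t) :=
  match t return (forall v : vertex t, bexpr (arity v)) -> expr (leaf t) with
  | Leaf => fun=> Var tt
  | Node k ch => fun B =>
      subst (fun i : 'I_k.+1 =>
               rename (@leaf_on k ch i)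
                 (composite (fun u : vertex (ch i) => B (vertex_on u))))
            (B None : bexpr k.+1)
  end.

(** The position in the composite expression of the sub-expression E_v, which
    arises from B v; the bracket pair of B v at position p becomes the bracket
    pair of the composite at position [graft B v ++ p]. *)
Fixpoint graft (t : rptree) :
    (forall v : vertex t, bexpr (arity v)) -> vertex t -> position :=
  match t return (forall v : vertex t, bexpr (arity v)) -> vertex t -> position
  with
  | Leaf => fun _ _ => [::]
  | Node k ch => fun B v =>
      if v is Some u then
        var_position (B None : bexpr k.+1) (tag u) ++
        graft (fun w : vertex (ch (tag u)) => B (vertex_on w)) (tagged u)
      else [::]
  end.

Lemma vars_subst (S T : Type) (s : S -> expr T) (e : expr S) :
  vars (subst s e) = flatten [seq vars (s x) | x <- vars e].
Proof.
by elim: e => [x|y IHy z IHz|y IHy z IHz] /=;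
  rewrite ?cats0 // map_cat flatten_cat IHy IHz.
Qed.

Lemma vars_rename (S T : Type) (f : S -> T) (e : expr S) :
  vars (rename f e) = map f (vars e).
Proof. by rewrite vars_subst; elim: (vars e) => //= x s ->. Qed.

Lemma perm_vars_composite (t : rptree) (B : forall v : vertex t, bexpr (arity v)) :
  perm_eq (vars (composite B)) (enum (leaf t)).
Proof.
elim: t B => [|k ch IH] B; first by rewrite /= enumT unlock.
rewrite enum_leaf_Node /= vars_subst.
have /= := valP (B None : bexpr k.+1) => /(perm_map (fun i =>
  vars (rename (@leaf_on k ch i)
    (composite (fun u : vertex (ch i) => B (vertex_on u))))))
  /perm_flatten H.
apply: perm_trans H _.
elim: (enum _) => //= i s IHs; apply: perm_cat => //.
by rewrite vars_rename perm_map.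
Qed.

Lemma f_expr_subproof (t : rptree) (B : forall v : vertex t, bexpr (arity v)) :
  perm_eq (vars (rename (@enum_rank (leaf t)) (composite B)))
          (enum 'I_(nleaves t)).
Proof.
rewrite vars_rename (perm_trans (perm_map _ (perm_vars_composite B))) //.
apply: uniq_perm; rewrite ?enum_uniq ?(map_inj_uniq enum_rank_inj) ?enum_uniq //.
by move=> i; rewrite mem_enum -(enum_valK i) mem_map ?mem_enum //; apply: enum_rank_inj.
Qed.

Section StructureMaps.
Variables (R : comNzRingType) (t : rptree).

Notation bexprs := (forall v : vertex t, bexpr (arity v)).

(** The expression E. *)
Definition f_expr (B : bexprs) : bexpr (nleaves t) :=
  BExpr (f_expr_subproof B).

Definition tensor_bexpr : lmodType R :=
  tensor R (fun v : vertex t => bexpr (arity v)).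

Definition f_even : tensor_bexpr -> {freeg (bexpr (nleaves t)) / R} :=
  fglift (fun B : {dffun bexprs} =>
            << f_expr B >> : {freeg (bexpr (nleaves t)) / R}).

(** Here and below, vs is the fixed ordering of the internal vertices. *)
Definition rho_sign (vs : seq (vertex t)) (B : bexprs) : R :=
  sign [seq graft B v ++ p | v <- vs, p <- brackets (B v)]
       (brackets (f_expr B)) R.

Definition f_odd (vs : seq (vertex t)) :
    tensor_bexpr -> {freeg (bexpr (nleaves t)) / R} :=
  fglift (fun B : {dffun bexprs} => rho_sign vs B *: << f_expr B >>).

(** * The map g *)

(** The nadir and the labels J_v(i) for leaves given by their labels. *)
Definition nadir_at (i j : 'I_(nleaves t)) : option (vertex t) :=
  nadir (enum_val i) (enum_val j).

Definition J (v : vertex t) (i : 'I_(nleaves t)) : option 'I_(arity v) :=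
  branch v (enum_val i).

(** The edge of D_v arising from an edge between i and j, if there is one; [mk]
    is [mk_arrow] or [mk_edge]. By [edge_at_isSome] below there is one exactly
    when v is the nadir. *)
Definition edge_at (E : nat -> Type) (mk : forall n, 'I_n -> 'I_n -> option (E n))
    (v : vertex t) (i j : 'I_(nleaves t)) : option (E (arity v)) :=
  if nadir_at i j == Some v then
    if (J v i, J v j) is (Some a, Some b) then mk _ a b else None
  else None.

Definition g_diagram (d : diagram (nleaves t)) (v : vertex t) :
    diagram (arity v) :=
  seq_mset (pmap (fun a : arrow _ => edge_at mk_arrow v a.1 a.2) (enum_mset d)).

Definition g_odiagram (d : odiagram (nleaves t)) (v : vertex t) :
    odiagram (arity v) :=
  pmap (fun a : edge _ => edge_at mk_edge v a.1 a.2) d.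

Definition g_even :
    Delta R (nleaves t) -> tensor R (fun v : vertex t => diagram (arity v)) :=
  fglift (fun d => pure_tensor R (g_diagram d)).

(** The k-th edge of D is identified with the index k. *)
Definition pi_sign (vs : seq (vertex t)) (d : odiagram (nleaves t)) : R :=
  let edges := enum 'I_(size d) in
  let nadir_of k := let a := tnth (in_tuple d) k in nadir_at a.1 a.2 in
  sign [seq k | v <- vs, k <- [seq k <- edges | nadir_of k == Some v]] edges R.

Definition g_odd (vs : seq (vertex t)) :
    oDelta R (nleaves t) -> tensor R (fun v : vertex t => odiagram (arity v)) :=
  fglift (fun d => pi_sign vs d *: pure_tensor R (g_odiagram d)).

Definition even_tensor_pairing :
    tensor R (fun v : vertex t => diagram (arity v)) -> tensor_bexpr -> R :=
  tensor_pairing (fun v => @even_pair R (arity v)).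

Definition odd_tensor_pairing :
    tensor R (fun v : vertex t => odiagram (arity v)) -> tensor_bexpr -> R :=
  tensor_pairing (fun v => @odd_pair R (arity v)).

End StructureMaps.

Lemma edge_at_isSome (t : rptree) (v : vertex t) (i j : 'I_(nleaves t)) :
  i != j ->
  (edge_at mk_arrow v i j : bool) = (nadir_at i j == Some v) /\
  (edge_at mk_edge v i j : bool) = (nadir_at i j == Some v).
Proof.
move=> nij; rewrite /edge_at /J /nadir_at.
have /nadirP[w [a [b [-> bi bj nab]]]] : enum_val i != enum_val j.
  by rewrite (inj_eq enum_val_inj).
case: eqP => // -[E]; subst w; rewrite bi bj /mk_arrow /mk_edge insubT //=.
split=> //; case: ltngtP => [lt|lt|/val_inj E]; rewrite ?insubT //.
by rewrite E eqxx in nab.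
Qed.

(* Main.v *)
Require Import Defs.
From mathcomp Require Import all_boot all_order all_algebra all_fingroup.
From mathcomp Require Import finmap multiset freeg.

(** Let E be the composite expression, and let an edge of D between i and j have
    nadir v, with i and j over the branches a and b of v.  The smallest
    sub-expression of E containing x_i and x_j comes from the smallest
    sub-expression of B_v containing x_a and x_b, so beta_{D,E} is obtained from
    the maps beta_{D_v,B_v} by translating positions by the position of E_v in E,
    and left/right comparisons in E are those in B_v.  The bracket pairs of E are
    the disjoint union over v of the translated bracket pairs of B_v, hence
    beta_{D,E} is a bijection iff all the beta_{D_v,B_v} are.  In the even case the
    exponents add up.  In the odd case all signs compare lists that are
    rearrangements of each other; such signs are multiplicative under composition
    and under concatenation, and both sides equal the sign relating the list of
    images of the edges of D, in their order, to the list of bracket pairs of the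
    factors B_v, in the order of the tensor product. *)

(** * Signs of rearrangements *)

Section Signs.
Set Implicit Arguments.
Unset Strict Implicit.
Import GRing.Theory.
Local Open Scope ring_scope.
Variable R : comNzRingType.

(** Since [t] is duplicate-free, at most one permutation relates [s] to it, so the one picked in
    [sign] must be [p]. *)
Lemma signE (T : eqType) (n : nat) (p : 'S_n) (s t : seq T) :
  size s = n -> uniq t -> (forall i : 'I_n, onth s i = onth t (p i)) ->
  sign s t R = (-1) ^+ odd_perm p.
Proof.
move=> E; subst n => ut Hp; rewrite /sign /relating_perm.
case: pickP => [q /forallP Hq|/(_ p)/forallP[i]]; last by rewrite Hp.
suff -> : q = p by [].
apply/permP => i; apply/val_inj/(onth_inj _ _ _ ut).
  by rewrite gtn_min -(onthTE t (p i)) -Hp onthTE ltn_ord ?orbT.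
by have /eqP <- := Hq i; rewrite Hp.
Qed.

(** The size is a separate parameter [n] so that the permutations of successive rearrangements lie
    in one group and can be multiplied. *)
Lemma perm_eq_sign (T : eqType) (n : nat) (s t : seq T) :
  size s = n -> uniq t -> perm_eq s t ->
  exists2 p : 'S_n, forall i : 'I_n, onth s i = onth t (p i) &
                    sign s t R = (-1) ^+ odd_perm p.
Proof.
move=> sz ut pst.
have szt : size t == n by rewrite -(perm_size pst) sz.
have /tuple_permP[p Ep] : perm_eq s (Tuple szt) by [].
have Hp (i : 'I_n) : onth s i = onth t (p i).
  rewrite {1}Ep onth_map -[_ (enum _) _]/(onth (enum 'I_n) i).
  rewrite onthE (nth_map i) ?size_enum_ord //= nth_ord_enum.
  by rewrite (tnth_nth (tnth (Tuple szt) i)) onthE (nth_map (tnth (Tuple szt) i)) ?(eqP szt).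
by exists p => //; apply: signE.
Qed.

Lemma sign_trans (T : eqType) (s t u : seq T) :
  uniq u -> perm_eq s t -> perm_eq t u ->
  sign s t R * sign t u R = sign s u R.
Proof.
move=> uu pst ptu; have ut : uniq t by rewrite (perm_uniq ptu).
have [p Hp ->] := perm_eq_sign erefl ut pst.
have [q Hq ->] := perm_eq_sign (esym (perm_size pst)) uu ptu.
rewrite (@signE _ (size s) (p * q)%g) //; last by move=> i; rewrite Hp Hq permM.
by rewrite odd_permM signr_addb.
Qed.

Lemma sign_refl (T : eqType) (s : seq T) : uniq s -> sign s s R = 1.
Proof. by move=> us; rewrite (@signE _ (size s) 1%g) ?odd_perm1 // => i; rewrite perm1. Qed.

(** The two signs have product [sign s s], which is 1, and a sign squares to 1. *)
Lemma sign_sym (T : eqType) (s t : seq T) :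
  uniq t -> perm_eq s t -> sign s t R = sign t s R.
Proof.
move=> ut pst; have us : uniq s by rewrite (perm_uniq pst).
have pts : perm_eq t s by rewrite perm_sym.
rewrite -[LHS]mulr1 -(sign_refl us) -(sign_trans us pst pts) mulrA.
by rewrite -expr2 -exprM mulnC exprM sqrrN !expr1n mul1r.
Qed.

Lemma sign_map (S T : eqType) (f : S -> T) (s t : seq S) :
  uniq (map f t) -> perm_eq s t -> sign (map f s) (map f t) R = sign s t R.
Proof.
move=> uft pst; have [p Hp ->] := perm_eq_sign erefl (map_uniq uft) pst.
by apply: signE; rewrite ?size_map // => i; rewrite !onth_map Hp.
Qed.

Lemma sign_cons (T : eqType) (x : T) (s t : seq T) :
  uniq (x :: t) -> perm_eq s t -> sign (x :: s) (x :: t) R = sign s t R.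
Proof.
move=> uxt pst; have /andP[_ ut] := uxt.
have [p Hp ->] := perm_eq_sign erefl ut pst.
(* [lift_perm ord0 ord0 p] fixes the new head and acts as [p] on the tail, with the parity of
   [p]. *)
rewrite (@signE _ (size s).+1 (lift_perm ord0 ord0 p)) ?odd_lift_perm //.
move=> i; case: (unliftP ord0 i) => [j|] ->; last by rewrite lift_perm_id.
by rewrite lift_perm_lift /= Hp.
Qed.

Lemma sign_catl (T : eqType) (r s t : seq T) :
  uniq (r ++ t) -> perm_eq s t -> sign (r ++ s) (r ++ t) R = sign s t R.
Proof.
move=> + pst; elim: r => //= x r IH /andP[nx urt].
by rewrite sign_cons ?IH //= ?nx // perm_cat2l.
Qed.

(** The sign of an exchange of two blocks depends only on their lengths: both sides are compared
    with the exchange of two intervals of indices. *)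
Lemma sign_rot (S T : eqType) (s r : seq S) (s' r' : seq T) :
  size s = size s' -> size r = size r' -> uniq (r ++ s) -> uniq (r' ++ s') ->
  sign (s ++ r) (r ++ s) R = sign (s' ++ r') (r' ++ s') R.
Proof.
move=> Es Er.
have E (U : eqType) (q1 q2 : seq U) : uniq (q2 ++ q1) ->
  sign (q1 ++ q2) (q2 ++ q1) R =
  sign (iota 0 (size q1) ++ iota (size q1) (size q2))
       (iota (size q1) (size q2) ++ iota 0 (size q1)) R.
  (* [nth] requires a default [x]; if there is no element to take, both blocks are empty and both
     signs are 1. *)
  case E : (q1 ++ q2) => [|x q].
    by case: q1 q2 E => [|? ?] [|? ?] // _ _; rewrite !sign_refl.
  rewrite -{}E => u.
  have map1 : map (nth x (q1 ++ q2)) (iota 0 (size q1)) = q1.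
    by rewrite map_nth_iota0 ?size_cat ?leq_addr // take_size_cat.
  have map2 : map (nth x (q1 ++ q2)) (iota (size q1) (size q2)) = q2.
    rewrite map_nth_iota ?size_cat ?addKn //.
    by rewrite drop_size_cat // take_size.
  rewrite -(@sign_map _ _ (nth x (q1 ++ q2))) ?map_cat ?map1 ?map2 //.
  by rewrite perm_catC.
by move=> u u'; rewrite (E _ s r u) (E _ s' r' u') Es Er.
Qed.

(** First [s'] is rearranged behind the fixed block [s]. Rearranging [s] in front of [t'] is then
    conjugated by block exchanges into rearranging behind [t'], and the two exchanges cancel by
    [sign_rot]. *)
Lemma sign_cat (T : eqType) (s t s' t' : seq T) :
  uniq (t ++ t') -> perm_eq s t -> perm_eq s' t' ->
  sign (s ++ s') (t ++ t') R = sign s t R * sign s' t' R.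
Proof.
move=> u p p'.
have uC : uniq (t' ++ t) by rewrite uniq_catC.
have us : uniq (t' ++ s) by rewrite (perm_uniq (perm_cat (perm_refl t') p)).
have usC : uniq (s ++ t') by rewrite uniq_catC.
rewrite -(@sign_trans _ _ (s ++ t')) //; last 2 first.
- by rewrite perm_cat2l.
- by rewrite perm_cat2r.
rewrite sign_catl // mulrC; congr (_ * _).
have pC : perm_eq (t ++ t') (t' ++ t) by rewrite perm_catC.
have pC' : perm_eq (t' ++ t) (t ++ t') by rewrite perm_sym.
have ps : perm_eq (t' ++ s) (t' ++ t) by rewrite perm_cat2l.
have psC : perm_eq (s ++ t') (t' ++ s) by rewrite perm_catC.
rewrite -(sign_trans u psC (perm_trans ps pC')) -(sign_trans u ps pC').
rewrite (@sign_rot _ _ _ _ t t' (perm_size p)) // sign_catl //.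
by rewrite mulrCA (sign_trans u pC pC') sign_refl // mulr1.
Qed.

Lemma sign_flatten (T I : eqType) (X Y : I -> seq T) (vs : seq I) :
  uniq (flatten (map Y vs)) -> {in vs, forall v, perm_eq (X v) (Y v)} ->
  sign (flatten (map X vs)) (flatten (map Y vs)) R =
  \prod_(v <- vs) sign (X v) (Y v) R.
Proof.
elim: vs => [|v vs IH] /=; first by rewrite big_nil sign_refl.
move=> u H; have Hvs : {in vs, forall w, perm_eq (X w) (Y w)}.
  by move=> w wvs; apply: H; rewrite inE wvs orbT.
rewrite big_cons sign_cat ?H ?mem_head ?IH //.
  by move: u; rewrite cat_uniq => /and3P[].
elim: (vs) Hvs => //= w ws IHw Hw; apply: perm_cat; rewrite ?Hw ?mem_head //.
by apply: IHw => z zws; rewrite Hw // inE zws orbT.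
Qed.

End Signs.

(** * Bracket expressions under substitution *)

Section Expressions.
Set Implicit Arguments.
Unset Strict Implicit.

Lemma dotted_vars (T : eqType) (e : expr T) (i j : T) :
  dotted e i j -> (i \in vars e) && (j \in vars e).
Proof.
elim: e => //= y IHy z IHz; rewrite !mem_cat.
  by case/orP => [/IHy|/IHz] /andP[-> ->]; rewrite ?orbT.
by case/or4P => [/IHy|/IHz||] /andP[-> ->]; rewrite ?orbT.
Qed.

Lemma innermost_vars (T : eqType) (e : expr T) (i j : T) :
  innermost e i j -> (i \in vars e) && (j \in vars e).
Proof.
elim: e => //= y + z; rewrite !mem_cat;
  case: (innermost y i j) (innermost z i j) => [p|] [q|] //=.
- by move=> /(_ isT)/andP[-> ->].
- by move=> /(_ isT)/andP[-> ->].
- by move=> _ /(_ isT)/andP[-> ->]; rewrite !orbT.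
- by case: ifP.
- by move=> /(_ isT)/andP[-> ->].
- by move=> /(_ isT)/andP[-> ->].
- by move=> _ /(_ isT)/andP[-> ->]; rewrite !orbT.
Qed.

(** Distinct variables are separated at some product: a bracket there contains both of them, and a
    dot makes them dotted. *)
Lemma innermost_or_dotted (T : eqType) (e : expr T) (i j : T) :
  i != j -> i \in vars e -> j \in vars e -> innermost e i j || dotted e i j.
Proof.
move=> nij; elim: e => /= [x|y IHy z IHz|y IHy z IHz].
- by rewrite !inE => /eqP ix /eqP jx; rewrite ix jx eqxx in nij.
- by move=> -> ->; case: innermost => //; case: innermost.
rewrite !mem_cat => /orP[] hi /orP[] hj; rewrite ?hi ?hj ?orbT //.
  by have := IHy hi hj; case: innermost => //= ->; rewrite orbT.
have := IHz hi hj; case: (innermost z i j) => [p _|/= ->]; last by rewrite !orbT.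
by case: innermost.
Qed.

Lemma beta_notin (T : eqType) (e : expr T) (i j : T) :
  ~~ ((i \in vars e) && (j \in vars e)) ->
  innermost e i j = None /\ dotted e i j = false.
Proof.
move=> nin; split; last by apply: contraNF nin; apply: dotted_vars.
by case E : innermost => [p|//]; case/negP: nin; apply: innermost_vars; rewrite E.
Qed.

(* The shape shared by the recursions for [beta] and [left_of] on a product of
   y and z: [mid] and [mid'] are the values on separated pairs, with i
   respectively j in y. *)
Definition combine (T : eqType) (A : Type) (f : bool -> A -> A) (mid mid' : A)
    (b : expr T -> T -> T -> A) (y z : expr T) (i j : T) : A :=
  if i \in vars y then if j \in vars y then f false (b y i j) else mid
  else if j \in vars y then mid' else f true (b z i j).

(** For two variables in the same factor the outer bracket never matters: if no bracket pair of that
    factor contains both, they are dotted there by [innermost_or_dotted], and [beta] is undefined in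
    any case. *)
Lemma beta_rec (T : eqType) (y z : expr T) (i j : T) :
  uniq (vars y ++ vars z) -> i != j ->
  i \in vars y ++ vars z -> j \in vars y ++ vars z ->
  let c mid := combine (fun d => omap (cons d)) mid mid (@beta T) y z i j in
  beta (Bra y z) i j = c (Some [::]) /\ beta (Defs.Dot y z) i j = c None.
Proof.
rewrite cat_uniq => /and3P[_ /hasPn/= dis _] nij; rewrite /combine /beta /= !mem_cat.
have {dis}dis k : k \in vars y -> k \in vars z = false.
  by move=> ky; apply: contraTF ky => /dis.
have niy := @beta_notin _ y i j; have niz := @beta_notin _ z i j.
case: (boolP (i \in vars y)) => iy; case: (boolP (j \in vars y)) => jy /=.
- move=> _ _; have [|-> ->] := niz; first by rewrite dis.
  have := innermost_or_dotted nij iy jy; rewrite (dis i) // (dis j) //= !orbF.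
  by case: dotted; case: innermost.
- move=> _ jz; have [|-> ->] := niz; first by rewrite dis.
  by have [|-> ->] := niy; rewrite ?(negbTE jy) ?andbF ?jz.
- move=> iz _; have [|-> ->] := niz; first by rewrite (dis j) // andbF.
  by have [|-> ->] := niy; rewrite ?(negbTE iy) ?iz ?orbT.
- move=> iz jz; have [|-> ->] := niy; first by rewrite (negbTE iy).
  have := innermost_or_dotted nij iz jz; rewrite /= orbF.
  by case: dotted; case: innermost.
Qed.

Lemma left_of_rec (T : eqType) (y z : expr T) (i j : T) :
  left_of (Bra y z) i j = combine (fun=> id) true false (@left_of T) y z i j /\
  left_of (Defs.Dot y z) i j = combine (fun=> id) true false (@left_of T) y z i j.
Proof.
rewrite /left_of /combine /= !index_cat.
case: ifP => iy; case: ifP => jy; split=> //; rewrite ?ltn_add2l //.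
- by rewrite ltn_addr // index_mem.
- by rewrite ltn_addr // index_mem.
- by rewrite ltnNge (leq_trans (index_size _ _)) // leq_addr.
- by rewrite ltnNge (leq_trans (index_size _ _)) // leq_addr.
Qed.

Lemma beta_mem (T : eqType) (e : expr T) (i j : T) (p : position) :
  beta e i j = Some p -> p \in brackets e.
Proof.
rewrite /beta; case: ifP => // _; elim: e p => //= y IHy z IHz p.
  rewrite [p \in _]mem_cat in_cons.
  case: (innermost y i j) IHy => [q IH [<-]|_].
    by rewrite map_f // IH.
  case: (innermost z i j) IHz => [q IH [<-]|_].
    by rewrite (map_f _ (IH _ _)) // !orbT.
  by case: ifP => // _ [<-]; rewrite eqxx orbT.
rewrite [p \in _]mem_cat.
case: (innermost y i j) IHy => [q IH [<-]|_].
  by rewrite map_f // IH.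
case: (innermost z i j) IHz => // q IH [<-].
by rewrite (map_f _ (IH _ _)) // !orbT.
Qed.

(** Lets [edge_at_edge] disregard the order in which [mk_edge] stores the two ends. *)
Lemma beta_sym (T : eqType) (e : expr T) (i j : T) : beta e i j = beta e j i.
Proof.
have D : dotted e i j = dotted e j i.
  elim: e => //= y -> z -> //; congr [|| _, _ | _].
  by rewrite orbC andbC [X in _ || X]andbC; congr orb; rewrite andbC.
suff I : innermost e i j = innermost e j i by rewrite /beta D I.
by elim: e {D} => //= y -> z -> //; rewrite andbC.
Qed.

(** Positions in the two factors differ in their first turn. Hence a [perm_eq] with the bracket
    pairs expresses a bijection, and signs relative to them are well determined. *)
Lemma brackets_uniq (T : Type) (e : expr T) : uniq (brackets e).
Proof.
have inj b : injective (cons b : position -> position) by move=> p q [].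
have dis (s s' : seq position) : ~~ has (mem (map (cons false) s)) (map (cons true) s').
  by apply/hasPn => _ /mapP[p _ ->]; apply/negP => /= /mapP[].
have nin b (s : seq position) : [::] \notin map (cons b) s by apply/mapP => -[].
elim: e => //= y uy z uz; rewrite cat_uniq.
  rewrite cons_uniq !map_inj_uniq // uy uz andbT [has _ (_ :: _)]/= negb_or dis.
  by rewrite !nin.
by rewrite !map_inj_uniq // uy uz dis.
Qed.

(** * Positions and order of variables after a substitution *)

Section Substitution.
Variables (S T : eqType) (s : S -> expr T).

Lemma mem_vars_subst (e : expr S) (a : S) (i : T) :
  a \in vars e -> i \in vars (s a) -> i \in vars (subst s e).
Proof. by move=> ae ia; rewrite vars_subst; apply/flatten_mapP; exists a. Qed.

(** The variables of [s a] go to the same side as [a], because the two sides share no variable; so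
    the recursions on [subst s e] and on [e] take the same turns. *)
Lemma mem_vars_subst_left (y z : expr S) (a : S) (i : T) :
  uniq (vars (subst s y) ++ vars (subst s z)) ->
  a \in vars y ++ vars z -> i \in vars (s a) ->
  (i \in vars (subst s y)) = (a \in vars y).
Proof.
rewrite cat_uniq => /and3P[_ /hasPn/= dis _] + ia; rewrite mem_cat.
case: (boolP (a \in vars y)) => [ay _|_ /= az]; first exact: mem_vars_subst ia.
by apply/negbTE/dis/mem_vars_subst/ia.
Qed.

(** The recursion descends along the position of [a], collecting its turns as a prefix, until it
    reaches the copy of [s a]. *)
Lemma beta_subst_same (e : expr S) (a : S) (i j : T) :
  uniq (vars (subst s e)) -> a \in vars e -> i != j ->
  i \in vars (s a) -> j \in vars (s a) ->
  beta (subst s e) i j = omap (cat (var_position e a)) (beta (s a) i j) /\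
  left_of (subst s e) i j = left_of (s a) i j.
Proof.
move=> + + nij ia ja; elim: e => /= [x _|y IHy z IHz u ayz|y IHy z IHz u ayz].
- by rewrite inE => /eqP <-; case: beta.
- have [-> _] := beta_rec u nij (mem_vars_subst (e := Bra y z) ayz ia)
                                (mem_vars_subst (e := Bra y z) ayz ja).
  have [-> _] := left_of_rec (subst s y) (subst s z) i j.
  rewrite /combine !(mem_vars_subst_left u ayz) //.
  move: u ayz; rewrite cat_uniq mem_cat => /and3P[uy _ uz].
  case: (a \in vars y) IHy => [IHy _|_ /= az].
    by have [-> ->] := IHy uy isT; case: beta.
  by have [-> ->] := IHz uz az; case: beta.
- have [_ ->] := beta_rec u nij (mem_vars_subst (e := Bra y z) ayz ia)
                                (mem_vars_subst (e := Bra y z) ayz ja).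
  have [_ ->] := left_of_rec (subst s y) (subst s z) i j.
  rewrite /combine !(mem_vars_subst_left u ayz) //.
  move: u ayz; rewrite cat_uniq mem_cat => /and3P[uy _ uz].
  case: (a \in vars y) IHy => [IHy _|_ /= az].
    by have [-> ->] := IHy uy isT; case: beta.
  by have [-> ->] := IHz uz az; case: beta.
Qed.

(** The recursions on [subst s e] and on [e] run in parallel and stop where [a] and [b] separate,
    before any substituted expression is entered. *)
Lemma beta_subst_diff (e : expr S) (a b : S) (i j : T) :
  uniq (vars (subst s e)) -> uniq (vars e) -> a \in vars e -> b \in vars e ->
  a != b -> i != j -> i \in vars (s a) -> j \in vars (s b) ->
  beta (subst s e) i j = beta e a b /\ left_of (subst s e) i j = left_of e a b.
Proof.
move=> + + + + nab nij ia jb.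
elim: e => /= [x _ _|y IHy z IHz u uyz ayz byz|y IHy z IHz u uyz ayz byz].
- by rewrite !inE => /eqP ax /eqP bx; rewrite ax bx eqxx in nab.
- have [-> _] := beta_rec u nij (mem_vars_subst (e := Bra y z) ayz ia)
                                (mem_vars_subst (e := Bra y z) byz jb).
  have [-> _] := left_of_rec (subst s y) (subst s z) i j.
  have [-> _] := beta_rec uyz nab ayz byz; have [-> _] := left_of_rec y z a b.
  rewrite /combine (mem_vars_subst_left u ayz) // (mem_vars_subst_left u byz) //.
  move: u uyz ayz byz; rewrite !cat_uniq !mem_cat => /and3P[uy _ uz] /and3P[uy' _ uz'].
  case: (a \in vars y) IHy => IHy; case: (b \in vars y) IHy => //= IHy az bz.
    by have [-> ->] := IHy uy uy' isT isT.
  by have [-> ->] := IHz uz uz' az bz.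
- have [_ ->] := beta_rec u nij (mem_vars_subst (e := Bra y z) ayz ia)
                                (mem_vars_subst (e := Bra y z) byz jb).
  have [_ ->] := left_of_rec (subst s y) (subst s z) i j.
  have [_ ->] := beta_rec uyz nab ayz byz; have [_ ->] := left_of_rec y z a b.
  rewrite /combine (mem_vars_subst_left u ayz) // (mem_vars_subst_left u byz) //.
  move: u uyz ayz byz; rewrite !cat_uniq !mem_cat => /and3P[uy _ uz] /and3P[uy' _ uz'].
  case: (a \in vars y) IHy => IHy; case: (b \in vars y) IHy => //= IHy az bz.
    by have [-> ->] := IHy uy uy' isT isT.
  by have [-> ->] := IHz uz uz' az bz.
Qed.

(** Equality holds only up to order: the bracket pairs coming from [e] are interleaved with those of
    the substituted expressions. *)
Lemma brackets_subst (e : expr S) : uniq (vars e) ->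
  perm_eq (brackets (subst s e))
    (brackets e ++ [seq var_position e x ++ p | x <- vars e, p <- brackets (s x)]).
Proof.
have Hl (y : expr S) d (f : S -> position) :
    {in vars y, forall x, f x = d :: var_position y x} ->
    [seq f x ++ p | x <- vars y, p <- brackets (s x)] =
    map (cons d) [seq var_position y x ++ p | x <- vars y, p <- brackets (s x)].
  move=> Hf; rewrite map_allpairs; apply/eq_in_allpairs_dep => x xy p _.
  by rewrite Hf.
have Hyz (y z : expr S) : {in vars z, forall x, x \notin vars y} ->
    [seq (if x \in vars y then false :: var_position y x
          else true :: var_position z x) ++ p
       | x <- vars y ++ vars z, p <- brackets (s x)] =
    map (cons false) [seq var_position y x ++ p | x <- vars y, p <- brackets (s x)] ++
    map (cons true) [seq var_position z x ++ p | x <- vars z, p <- brackets (s x)].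
  move=> dis; rewrite allpairs_cat; congr cat.
    by apply: Hl => x ->.
  by apply: Hl => x /dis/negbTE->.
elim: e => /= [x _|y IHy z IHz|y IHy z IHz].
- by rewrite cats0 map_id.
- rewrite cat_uniq => /and3P[uy /hasPn/= dis uz].
  rewrite Hyz //.
  (* Counting the positions that satisfy an arbitrary [P] turns the rearrangement into commutativity
     of addition. *)
  apply/seq.permP => P; move/seq.permP: (IHy uy) => {}IHy; move/seq.permP: (IHz uz) => {}IHz.
  rewrite !(count_cat, count_map) /= !(count_cat, count_map).
  rewrite (IHy (preim _ P)) (IHz (preim _ P)) !count_cat.
  by rewrite -!addnA; congr addn; rewrite addnCA; congr addn; rewrite addnCA.
- rewrite cat_uniq => /and3P[uy /hasPn/= dis uz].
  rewrite Hyz //.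
  apply/seq.permP => P; move/seq.permP: (IHy uy) => {}IHy; move/seq.permP: (IHz uz) => {}IHz.
  rewrite !(count_cat, count_map) (IHy (preim _ P)) (IHz (preim _ P)) !count_cat.
  by rewrite -!addnA; congr addn; rewrite addnCA.
Qed.

End Substitution.

Lemma brackets_rename (S T : Type) (f : S -> T) (e : expr S) :
  brackets (rename f e) = brackets e.
Proof. by elim: e => //= y IHy z IHz; rewrite -/(rename f y) -/(rename f z) IHy IHz. Qed.

(** A renaming substitutes single variables, so distinct variables always fall under
    [beta_subst_diff]. *)
Lemma beta_rename (S T : eqType) (f : S -> T) (e : expr S) (a b : S) :
  injective f -> uniq (vars e) -> a \in vars e -> b \in vars e -> a != b ->
  beta (rename f e) (f a) (f b) = beta e a b /\
  left_of (rename f e) (f a) (f b) = left_of e a b.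
Proof.
move=> inj_f u ae be nab; apply: beta_subst_diff; rewrite ?inE ?(inj_eq inj_f) //.
by rewrite -/(rename f e) vars_rename map_inj_uniq.
Qed.

End Expressions.

(** * Composites along a tree *)

Section Trees.
Set Implicit Arguments.
Unset Strict Implicit.

Lemma uniq_vars_bexpr (m : nat) (b : bexpr m) : uniq (vars b).
Proof. by rewrite (perm_uniq (valP b)) enum_uniq. Qed.

Lemma mem_vars_bexpr (m : nat) (b : bexpr m) (i : 'I_m) : i \in vars b.
Proof. by rewrite (perm_mem (valP b)) mem_enum. Qed.

Lemma uniq_vars_composite (t : rptree) (B : forall v : vertex t, bexpr (arity v)) :
  uniq (vars (composite B)).
Proof. by rewrite (perm_uniq (perm_vars_composite B)) enum_uniq. Qed.

Lemma mem_vars_composite (t : rptree) (B : forall v : vertex t, bexpr (arity v))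
  (l : leaf t) : l \in vars (composite B).
Proof. by rewrite (perm_mem (perm_vars_composite B)) mem_enum. Qed.

Lemma leaf_on_inj k (ch : 'I_k.+1 -> rptree) i : injective (@leaf_on k ch i).
Proof. by move=> u v /eqP; rewrite -tag_eqE /tag_eq /= eqxx tagged_asE => /eqP. Qed.

(** Induction on the tree. Leaves over one branch have their nadir in that subtree, and
    [beta_subst_same] supplies the first part of [graft]; leaves over different branches have the
    root vertex as nadir, where [graft] is empty. *)
Lemma beta_composite (t : rptree) (B : forall v : vertex t, bexpr (arity v))
    (l m : leaf t) (v : vertex t) (a b : 'I_(arity v)) :
  l != m -> nadir l m = Some v -> branch v l = Some a -> branch v m = Some b ->
  beta (composite B) l m = omap (cat (graft B v)) (beta (B v) a b) /\
  left_of (composite B) l m = left_of (B v) a b.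
Proof.
elim: t B l m v a b => [|k ch IH] B; first by case; case.
move=> [i l] [j m] v a b nlm; case: (eqVneq i j) => [E|nij].
  subst j.
  have nlm' : l != m by apply: contraNneq nlm => ->.
  have [v' [a' [b' [nd bl bm nab]]]] := nadirP nlm'.
  have := nadir_same l m; rewrite nd /= => -> [E]; subst v.
  move=> Ea Eb.
  have {}Ea : a = a' by have := etrans (esym Ea) (etrans (branch_on _ _) bl); case.
  have {}Eb : b = b' by have := etrans (esym Eb) (etrans (branch_on _ _) bm); case.
  subst a b.
  pose s i := rename (@leaf_on k ch i) (composite (fun u : vertex (ch i) => B (vertex_on u))).
  have mem (x : leaf (ch i)) : leaf_on x \in vars (s i).
    by rewrite vars_rename map_f // mem_vars_composite.
  have [-> ->] := beta_subst_same (uniq_vars_composite B)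
                    (mem_vars_bexpr (B None : bexpr k.+1) i) nlm (mem l) (mem m).
  have [-> ->] := beta_rename (@leaf_on_inj k ch i)
    (uniq_vars_composite (fun u : vertex (ch i) => B (vertex_on u)))
    (mem_vars_composite _ l) (mem_vars_composite _ m) nlm'.
  have [-> ->] := IH i (fun u => B (vertex_on u)) l m v' a' b' nlm' nd bl bm.
  by split=> //=; case: beta => //= p; rewrite catA.
have -> := nadir_diff l m nij; case=> E; subst v => -[] /= E; subst a => -[] E; subst b.
have mem i' (x : leaf (ch i')) : leaf_on x \in
    vars (rename (@leaf_on k ch i') (composite (fun u : vertex (ch i') => B (vertex_on u)))).
  by rewrite vars_rename map_f // mem_vars_composite.
have [-> ->] := beta_subst_diff (uniq_vars_composite B) (uniq_vars_bexpr (B None : bexpr k.+1))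
  (mem_vars_bexpr _ i) (mem_vars_bexpr _ j) nij nlm (mem i l) (mem j m).
by split=> //; case: beta.
Qed.

Lemma enum_vertex_Node k (ch : 'I_k.+1 -> rptree) :
  enum (vertex (Node ch)) =
  None :: [seq vertex_on v | i <- enum 'I_k.+1, v <- enum (vertex (ch i))].
Proof.
rewrite /= enumT unlock /= /option_enum [in LHS]unlock /= /tag_enum.
rewrite map_flatten -map_comp -enumT; congr (_ :: flatten _).
by apply: eq_map => i /=; rewrite -map_comp -enumT.
Qed.

Lemma brackets_composite (t : rptree) (B : forall v : vertex t, bexpr (arity v)) :
  perm_eq (brackets (composite B))
          [seq graft B v ++ p | v <- enum (vertex t), p <- brackets (B v)].
Proof.
elim: t B => [|k ch IH] B; first by rewrite /= enumT unlock.
rewrite enum_vertex_Node /=.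
apply: perm_trans (brackets_subst _ (uniq_vars_bexpr (B None : bexpr k.+1))) _.
(* The root vertex is grafted at the empty position, so its own bracket pairs cancel and only the
   branches remain. *)
rewrite [X in perm_eq _ X]allpairs_cons /= map_id perm_cat2l.
pose X i := [seq var_position (B None : bexpr k.+1) i ++ p |
               p <- brackets (composite (fun u : vertex (ch i) => B (vertex_on u)))].
rewrite (_ : flatten _ = flatten (map X (vars (B None : bexpr k.+1)))); last first.
  by congr flatten; apply: eq_map => i; rewrite brackets_rename.
(* The branches appear in the order of the variables of [B None]; they are put back into their
   planar order. *)
apply: perm_trans (perm_flatten (perm_map X (valP (B None : bexpr k.+1)))) _.
elim: (enum _) => //= i s IHs; rewrite allpairs_cat; apply: perm_cat => //.
apply: perm_trans (perm_map _ (IH i _)) _.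
rewrite map_allpairs allpairs_mapl /=.
by under eq_allpairs => v p do rewrite catA.
Qed.
End Trees.

(** * Linear extensions and families of lists *)

Section LinearAndFamilies.
Set Implicit Arguments.
Unset Strict Implicit.
Import GRing.Theory.
Local Open Scope ring_scope.

Section LinearExtension.
Variables (R : comNzRingType) (K : choiceType) (M : lmodType R).
Implicit Types (f : K -> M) (D : {freeg K / R}).

Lemma fglift0 f : fglift f 0 = 0.
Proof. by rewrite -[X in fglift f X](subrr 0) (lift_is_additive f) subrr. Qed.

Lemma fgliftD f : {morph fglift f : D D' / D + D'}.
Proof.
move=> D D'; rewrite -{1}[D']opprK -[- D']add0r.
by rewrite !(lift_is_additive f) fglift0 sub0r opprK.
Qed.

Lemma fglift_sum f (I : Type) (s : seq I) (F : I -> {freeg K / R}) :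
  fglift f (\sum_(i <- s) F i) = \sum_(i <- s) fglift f (F i).
Proof. exact: (big_morph _ (fgliftD f) (fglift0 f)). Qed.

Lemma fglift_sumE f D : fglift f D = \sum_(z <- dom D) coeff z D *: f z.
Proof.
by rewrite -{1}[D]freeg_sumE fglift_sum; apply: eq_bigr => z _; rewrite liftU.
Qed.

Lemma fgliftZ f c : {morph fglift f : D / c *: D}.
Proof.
move=> D; rewrite [in RHS]fglift_sumE scaler_sumr [c *: D]/(fgscale c D) /fgscale fglift_sum.
by apply: eq_bigr => z _; rewrite liftU scalerA.
Qed.

Lemma eq_fglift f f' : f =1 f' -> fglift f =1 fglift f'.
Proof. by move=> E D; rewrite !fglift_sumE; apply: eq_bigr => z _; rewrite E. Qed.

End LinearExtension.

Lemma fglift_comp (R : comNzRingType) (K K' : choiceType) (M : lmodType R)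
    (f : K' -> M) (h : K -> {freeg K' / R}) (D : {freeg K / R}) :
  fglift f (fglift h D) = fglift (fun k => fglift f (h k)) D.
Proof.
rewrite [fglift h D]fglift_sumE [RHS]fglift_sumE fglift_sum.
by apply: eq_bigr => z _; rewrite fgliftZ.
Qed.

Section Partition.
Variables (V A : eqType) (c : A -> option V).

Lemma perm_flatten_class (vs : seq V) (s : seq A) :
  uniq vs -> (forall a, exists2 v, v \in vs & c a = Some v) ->
  perm_eq (flatten [seq [seq a <- s | c a == Some v] | v <- vs]) s.
Proof.
move=> uvs Hc.
(* Generalised for the induction on [vs]: the classes listed so far collect exactly the elements
   whose class lies in [vs]. *)
suff H : perm_eq (flatten [seq [seq a <- s | c a == Some v] | v <- vs])
                 [seq a <- s | has (fun v => c a == Some v) vs].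
  rewrite (all_filterP _) // in H; apply/allP => a _; apply/hasP.
  by have [v vvs ->] := Hc a; exists v.
elim: vs uvs {Hc} => [_|v vs IH /= /andP[nv uvs]]; first by rewrite /= filter_pred0.
apply: perm_trans (perm_cat (perm_refl _) (IH uvs)) _.
(* Split by class [v]: since [v] does not recur in [vs], the complement is the list of the induction
   hypothesis. *)
have := permEl (perm_filterC (fun a => c a == Some v)
  [seq a <- s | (c a == Some v) || has (fun v => c a == Some v) vs]).
rewrite -!filter_predI.
congr (perm_eq (_ ++ _) _); apply: eq_filter => a /=.
  by case: eqP.
case: eqP => //= ->; apply/esym/negbTE/hasPn => w wvs; apply: contraNneq nv => -[->].
by [].
Qed.

End Partition.

(** Applied with [f] the passage from an edge of D to an edge of D_v, and [P] selecting the edges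
    with nadir v. *)
Lemma map_pmap (A E C : Type) (f : A -> option E) (P : pred A) (g : E -> C)
    (h : A -> C) (s : seq A) :
  (forall a, if P a then exists2 e, f a = Some e & g e = h a else f a = None) ->
  map g (pmap f s) = map h (filter P s).
Proof.
move=> H; elim: s => //= a s IH; have := H a.
by case: (P a) => [[e -> /= ->]|->] /=; rewrite IH.
Qed.

Section Family.
Variables (T I U : eqType) (vs : seq I) (F : I -> U -> T).

Lemma flatten_disjoint (Z : I -> seq T) (v w : I) (z : T) :
  uniq (flatten (map Z vs)) -> v \in vs -> w \in vs ->
  z \in Z v -> z \in Z w -> v = w.
Proof.
elim: vs => //= x s IH; rewrite cat_uniq => /and3P[_ /hasPn/= dis us].
have nin y : y \in s -> z \in Z y -> z \notin Z x.
  by move=> ys zy; apply: dis; apply/flatten_mapP; exists y.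
rewrite !inE => /predU1P[->|vs'] /predU1P[->|ws'] // zv zw; last exact: IH.
  by have := nin _ ws' zw; rewrite zv.
by have := nin _ vs' zv; rewrite zw.
Qed.

Lemma uniq_flatten_mem (Z : I -> seq T) (v : I) :
  uniq (flatten (map Z vs)) -> v \in vs -> uniq (Z v).
Proof.
elim: vs => //= x s IH; rewrite cat_uniq inE => /and3P[ux _ us] /predU1P[->//|].
exact: IH.
Qed.

(** Since [G Y] is duplicate-free, an element of it determines both its index and its preimage in
    [Y]. The last hypothesis is restricted to elements landing in [G Y] so that the [X v] may
    contain undefined images, which all the [F v] send to [None]. *)
Lemma perm_flatten_family (X Y : I -> seq U) :
  let G (Z : I -> seq U) := flatten [seq map (F v) (Z v) | v <- vs] in
  (forall v, injective (F v)) -> uniq (G Y) ->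
  {in vs, forall v x, x \in X v -> F v x \in G Y -> x \in Y v} ->
  perm_eq (G X) (G Y) = all (fun v => perm_eq (X v) (Y v)) vs.
Proof.
move=> G inj uG H; apply/idP/allP => [pXY v vvs|]; last first.
  rewrite /G; elim: (vs) => //= v s IH Hs; apply: perm_cat.
    by apply: perm_map; apply: Hs; rewrite mem_head.
  by apply: IH => w ws; apply: Hs; rewrite inE ws orbT.
have uX : uniq (G X) by rewrite (perm_uniq pXY).
have mG Z w x : w \in vs -> x \in Z w -> F w x \in G Z.
  by move=> wvs xZ; apply/flatten_mapP; exists w => //; apply: map_f.
apply: uniq_perm.
- by have /map_uniq := uniq_flatten_mem uX vvs.
- by have /map_uniq := uniq_flatten_mem uG vvs.
move=> x; apply/idP/idP => [xX|xY].
  by apply: H => //; rewrite -(perm_mem pXY); apply: mG.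
have: F v x \in G X by rewrite (perm_mem pXY); apply: mG.
case/flatten_mapP => w wvs /mapP[y yX E].
have yY : y \in Y w by apply: H => //; rewrite -E; apply: mG.
have Evw : v = w.
  apply: (flatten_disjoint uG vvs wvs (map_f _ xY)).
  by rewrite E; apply: map_f.
by subst w; move/inj: E => ->.
Qed.
End Family.
End LinearAndFamilies.

(** * Duality *)

Section Duality.
Set Implicit Arguments.
Unset Strict Implicit.
Import GRing.Theory.
Local Open Scope ring_scope.
Variables (R : comNzRingType) (t : rptree) (vs : seq (vertex t)).
Hypothesis vs_ordering : perm_eq vs (enum (vertex t)).
Variable B : forall v : vertex t, bexpr (arity v).

Lemma uniq_vs : uniq vs.
Proof. by rewrite (perm_uniq vs_ordering) enum_uniq. Qed.

Lemma mem_vs v : v \in vs.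
Proof. by rewrite (perm_mem vs_ordering) mem_enum. Qed.

Definition lift_beta (v : vertex t) : option position -> option position :=
  omap (cat (graft B v)).

Definition targets (v : vertex t) : seq (option position) := map Some (brackets (B v)).

Lemma left_of_sym (T : eqType) (e : expr T) (i j : T) :
  i != j -> i \in vars e -> left_of e j i = ~~ left_of e i j.
Proof.
move=> nij ie; rewrite /left_of -leqNgt ltn_neqAle andb_idl // => _.
apply: contraNneq nij => E; rewrite -(nth_index i ie) -E nth_index //.
by rewrite -index_mem E index_mem.
Qed.

Lemma beta_f_expr (i j : 'I_(nleaves t)) : i != j ->
  exists v (a b : 'I_(arity v)),
    [/\ nadir_at i j = Some v, J v i = Some a, J v j = Some b, a != b
      & lift_beta v (beta (B v) a b) = beta (f_expr B) i j /\
        left_of (B v) b a = left_of (f_expr B) j i].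
Proof.
move=> nij; have nij' : enum_val i != enum_val j by rewrite (inj_eq enum_val_inj).
have [v [a [b [nd bi bj nab]]]] := nadirP nij'.
exists v, a, b; split=> //.
(* [even_pair] asks whether the head is left of the tail, [beta_composite] whether the tail is left
   of the head; for distinct ends these are negations of each other. *)
rewrite !(@left_of_sym _ _ _ _ nij) ?(@left_of_sym _ _ _ _ nab) ?mem_vars_bexpr //.
have [E1 E2] := beta_composite B nij' nd bi bj; rewrite /lift_beta -E1 -E2.
have := beta_rename (@enum_rank_inj (leaf t)) (uniq_vars_composite B)
  (mem_vars_composite B (enum_val i)) (mem_vars_composite B (enum_val j)) nij'.
by rewrite !enum_valK => -[<- <-].
Qed.

Lemma nadir_atE (i j : 'I_(nleaves t)) : i != j ->
  exists2 v, v \in vs & nadir_at i j = Some v.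
Proof.
by move=> /beta_f_expr[v [_ [_ [nd _ _ _ _]]]]; exists v; rewrite ?mem_vs.
Qed.

Lemma edge_at_arrow (v : vertex t) (a : arrow (nleaves t)) :
  if nadir_at a.1 a.2 == Some v then
    exists2 e : arrow (arity v), edge_at mk_arrow v a.1 a.2 = Some e &
      lift_beta v (beta (B v) e.1 e.2) = beta (f_expr B) a.1 a.2 /\
      left_of (B v) e.2 e.1 = left_of (f_expr B) a.2 a.1
  else edge_at mk_arrow v a.1 a.2 = None.
Proof.
rewrite /edge_at; case: eqP => // E.
have [w [x [y [nd Jx Jy nxy H]]]] := beta_f_expr (valP a).
move: nd; rewrite E => -[E']; subst w; rewrite Jx Jy /mk_arrow insubT.
by exists (Arrow (arrow_ends := (x, y)) nxy).
Qed.

Lemma edge_at_edge (v : vertex t) (a : edge (nleaves t)) :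
  if nadir_at a.1 a.2 == Some v then
    exists2 e : edge (arity v), edge_at mk_edge v a.1 a.2 = Some e &
      lift_beta v (beta (B v) e.1 e.2) = beta (f_expr B) a.1 a.2
  else edge_at mk_edge v a.1 a.2 = None.
Proof.
rewrite /edge_at; case: eqP => // E.
have na : a.1 != a.2 by have := valP a; rewrite neq_ltn => ->.
have [w [x [y [nd Jx Jy nxy [H _]]]]] := beta_f_expr na.
move: nd; rewrite E => -[E']; subst w; rewrite Jx Jy /mk_edge.
case: (ltngtP x y) => [lt|lt|/val_inj Exy]; last by rewrite Exy eqxx in nxy.
  by rewrite insubT; exists (Edge (edge_ends := (x, y)) lt).
by rewrite insubT; exists (Edge (edge_ends := (y, x)) lt); rewrite // beta_sym.
Qed.

Lemma brackets_f_expr :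
  perm_eq (map Some (brackets (f_expr B)))
          (flatten [seq map (lift_beta v) (targets v) | v <- vs]).
Proof.
rewrite brackets_rename.
have pvs := perm_flatten (perm_map (fun v => map (lift_beta v) (targets v)) vs_ordering).
rewrite (permPr pvs) (permPl (perm_map Some (brackets_composite B))).
rewrite map_flatten -map_comp.
rewrite (_ : map _ _ = [seq map (lift_beta v) (targets v) | v <- enum (vertex t)]) //.
by apply: eq_map => v /=; rewrite /targets -!map_comp; apply: eq_map.
Qed.

(* [X v] stands for the list of images of the edges of D_v under beta_{D_v,B_v}. *)
Lemma perm_eq_images (A : eqType) (ends : A -> 'I_(nleaves t) * 'I_(nleaves t))
    (D : seq A) (X : forall v : vertex t, seq (option position)) :
  (forall a, (ends a).1 != (ends a).2) ->
  (forall v, {subset X v <= None :: targets v}) ->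
  (forall v, map (lift_beta v) (X v) =
     [seq beta (f_expr B) (ends a).1 (ends a).2 |
        a <- D & nadir_at (ends a).1 (ends a).2 == Some v]) ->
  let images := [seq beta (f_expr B) (ends a).1 (ends a).2 | a <- D] in
  perm_eq (flatten [seq map (lift_beta v) (X v) | v <- vs]) images /\
  perm_eq images (map Some (brackets (f_expr B))) =
    all (fun v => perm_eq (X v) (targets v)) vs.
Proof.
move=> nends subX EX images.
have p1 : perm_eq (flatten [seq map (lift_beta v) (X v) | v <- vs]) images.
  have := perm_flatten_class D uniq_vs (fun a => nadir_atE (nends a)).
  move=> /(perm_map (fun a => beta (f_expr B) (ends a).1 (ends a).2)).
  rewrite map_flatten -map_comp; congr (perm_eq (flatten _) _).
  by apply: eq_map => v /=; rewrite EX.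
split=> //; rewrite -(permPl p1) (permPr brackets_f_expr).
apply: perm_flatten_family.
(* Translation is injective: the common prefix [graft B v] cancels. *)
- move=> v [p|] [q|] //= [E]; congr Some.
  by elim: (graft B v) E => //= b s IH [/IH].
- rewrite -(perm_uniq brackets_f_expr) map_inj_uniq ?brackets_uniq //.
  by move=> p q [].
(* An image outside the targets is [None], which stays [None] after translation and is not a bracket
   pair. *)
move=> v _ x /subX; rewrite inE => /predU1P[->|//].
by rewrite -(perm_mem brackets_f_expr) => /mapP[].
Qed.

Lemma subset_targets (E : Type) (v : vertex t) (ends : E -> 'I_(arity v) * 'I_(arity v))
    (s : seq E) :
  {subset [seq beta (B v) (ends e).1 (ends e).2 | e <- s] <= None :: targets v}.
Proof.
elim: s => //= e s IH x; rewrite inE => /predU1P[->|/IH//].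
case Ep : (beta _ _ _) => [p|]; rewrite inE //= map_f ?orbT //.
exact: beta_mem Ep.
Qed.

Lemma prod_vertices (F : vertex t -> R) : \prod_v F v = \prod_(v <- vs) F v.
Proof. by rewrite (perm_big _ vs_ordering) big_enum. Qed.

Lemma prod_if_all (P : pred (vertex t)) (F : vertex t -> R) :
  \prod_(v <- vs) (if P v then F v else 0) =
  if all P vs then \prod_(v <- vs) F v else 0.
Proof.
elim: (vs) => [|v s IH] /=; first by rewrite !big_nil.
by rewrite !big_cons IH; case: (P v); case: (all P s); rewrite ?mul0r ?mulr0.
Qed.

Lemma even_pair_g (d : diagram (nleaves t)) :
  even_pair R d (f_expr B) = \prod_v even_pair R (g_diagram d v) (B v).
Proof.
pose D := enum_mset d.
pose Dv v := pmap (fun a : arrow _ => edge_at mk_arrow v a.1 a.2) D.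
pose X v := [seq beta (B v) e.1 e.2 | e : arrow (arity v) <- Dv v].
pose c v := count (fun e : arrow _ => left_of (B v) e.2 e.1) (Dv v).
pose classes v := [seq a : arrow _ <- D | nadir_at a.1 a.2 == Some v].
have EX v : map (lift_beta v) (X v) =
    [seq beta (f_expr B) a.1 a.2 | a : arrow _ <- classes v].
  rewrite -map_comp; apply: map_pmap => a; have := edge_at_arrow v a.
  by case: ifP => // _ [e -> [E _]]; exists e.
have Ec v : c v = count (fun a : arrow _ => left_of (f_expr B) a.2 a.1) (classes v).
  (* Each count is read as a count of true values in a list of booleans, so that [map_pmap] applies
     to it as well. *)
  rewrite /c -(count_map _ id) -[RHS](count_map _ id); congr count.
  apply: map_pmap => a; have := edge_at_arrow v a.
  by case: ifP => // _ [e -> [_ E]]; exists e.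
have na (a : arrow (nleaves t)) : a.1 != a.2 := valP a.
have [_ E] := perm_eq_images na
  (fun v => @subset_targets _ v (fun e : arrow _ => (e : _ * _)) _) EX.
have EvE v : even_pair R (g_diagram d v) (B v) =
    if perm_eq (X v) (targets v) then (-1) ^+ c v else 0.
  (* The multiset D_v enumerates the list [Dv v] only up to order; neither the bijectivity test nor
     the exponent sees the difference. *)
  have pD : perm_eq (enum_mset (g_diagram d v)) (Dv v) := perm_eq_seq_mset _.
  by rewrite /even_pair (seq.permP pD) (permPl (perm_map _ pD)).
rewrite prod_vertices; under eq_bigr do rewrite EvE.
rewrite prod_if_all /even_pair E; case: ifP => // _.
rewrite prodrXr; congr (_ ^+ _).
have pC := perm_flatten_class D uniq_vs (fun a => nadir_atE (na a)).
rewrite -(seq.permP pC) count_flatten sumnE !big_map.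
by apply: eq_bigr => v _; rewrite Ec.
Qed.

Lemma odd_pair_g (d : odiagram (nleaves t)) :
  rho_sign R vs B * odd_pair R d (f_expr B) =
  pi_sign R vs d * \prod_v odd_pair R (g_odiagram d v) (B v).
Proof.
pose Dv v := pmap (fun a : edge _ => edge_at mk_edge v a.1 a.2) d.
pose X v := [seq beta (B v) e.1 e.2 | e : edge (arity v) <- Dv v].
pose img (a : edge (nleaves t)) := beta (f_expr B) a.1 a.2.
have EX v : map (lift_beta v) (X v) =
    [seq img a | a : edge _ <- d & nadir_at a.1 a.2 == Some v].
  rewrite -map_comp; apply: map_pmap => a; have := edge_at_edge v a.
  by case: ifP => // _ [e -> E]; exists e.
have na (a : edge (nleaves t)) : a.1 != a.2 by have := valP a; rewrite neq_ltn => ->.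
have [pX E] := perm_eq_images na
  (fun v => @subset_targets _ v (fun e : edge _ => (e : _ * _)) _) EX.
have ub : uniq (map Some (brackets (f_expr B))).
  by rewrite map_inj_uniq ?brackets_uniq // => p q [].
rewrite prod_vertices prod_if_all /odd_pair E; case: ifP => [pXY|]; last by rewrite !mulr0.
have pid : perm_eq (map img d) (map Some (brackets (f_expr B))) by rewrite E.
have ui : uniq (map img d) by rewrite (perm_uniq pid).
set Xs := flatten _ in pX.
set b := map Some _ in ub pid *.
pose T := flatten [seq map (lift_beta v) (targets v) | v <- vs].
have pbT : perm_eq b T := brackets_f_expr.
have uT : uniq T by rewrite -(perm_uniq pbT).
have some_inj : injective (@Some position) by move=> p q [].
(* [rho_sign] leads from the tensor order [T] to the left-to-right order [b]; it is reversed so as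
   to compose after the sign of D. *)
have -> : rho_sign R vs B = sign b T R.
  set T0 := [seq graft B v ++ p | v <- vs, p <- brackets (B v)].
  have ET : map Some T0 = T.
    rewrite map_flatten -map_comp; congr flatten.
    by apply: eq_map => v /=; rewrite /targets -!map_comp; apply: eq_map.
  rewrite (sign_sym _ uT pbT) -ET sign_map //.
  by apply: (perm_map_inj some_inj); rewrite ET perm_sym.
(* The images of the edges are pairwise distinct here, so the sign on edge indices can be read off
   on the images. *)
have -> : pi_sign R vs d = sign Xs (map img d) R.
  pose h (k : 'I_(size d)) := img (tnth (in_tuple d) k).
  pose nadir_of k := let a := tnth (in_tuple d) k in nadir_at a.1 a.2.
  have Ed : map (tnth (in_tuple d)) (enum 'I_(size d)) = d := map_tnth_enum (in_tuple d).
  rewrite /pi_sign; set K := flatten _; set e := enum _.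
  have pK : perm_eq K e.
    rewrite /K; under eq_map do rewrite map_id.
    exact: (perm_flatten_class e uniq_vs (fun k => nadir_atE (na (tnth (in_tuple d) k)))).
  have Ee : map h e = map img d by rewrite -[in RHS]Ed -[RHS]map_comp.
  have EK : map h K = Xs.
    rewrite /K /Xs map_flatten -map_comp; congr flatten; apply: eq_map => v /=.
    by rewrite map_id EX -[in RHS]Ed [in RHS]filter_map -[RHS]map_comp.
  by rewrite -EK -Ee sign_map // Ee.
have -> : \prod_(v <- vs) sign (X v) (targets v) R = sign Xs T R.
  rewrite sign_flatten //; last by move=> v /(allP pXY); apply: perm_map.
  rewrite !big_seq; apply: eq_bigr => v vvs; rewrite sign_map ?(allP pXY) //.
  exact: (uniq_flatten_mem uT vvs).
have pXT : perm_eq Xs T := perm_trans pX (perm_trans pid pbT).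
have pXs : perm_eq (map img d) Xs by rewrite perm_sym.
(* Both sides become the sign from [map img d] to [T], through [b] on the left and through [Xs] on
   the right. *)
by rewrite mulrC (sign_trans R uT pid pbT) (sign_sym R ui pX) (sign_trans R uT pXs pXT).
Qed.

End Duality.

(** * From basis elements to the free modules *)

Section BilinearExtension.
Import GRing.Theory.
Local Open Scope ring_scope.
Variables (R : comNzRingType) (K K' : choiceType) (p : K -> K' -> R).

Lemma bilinear_extZ (x : {freeg K / R}) (c : R) (k' : K') :
  bilinear_ext p x (c *: << k' >>) = fglift (fun k => c * p k k' : R^o) x.
Proof. by apply: (eq_fglift (M := R^o)) => k; rewrite fgliftZ liftU scale1r. Qed.

Lemma bilinear_extU (x : {freeg K / R}) (k' : K') :
  bilinear_ext p x << k' >> = fglift (fun k => p k k' : R^o) x.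
Proof. by apply: (eq_fglift (M := R^o)) => k; rewrite liftU scale1r. Qed.

End BilinearExtension.

Section TensorDuality.
Import GRing.Theory.
Local Open Scope ring_scope.
Variables (R : comNzRingType) (t : rptree) (vs : seq (vertex t)).
Hypothesis vs_ordering : perm_eq vs (enum (vertex t)).
Variable B : forall v : vertex t, bexpr (arity v).

Lemma even_duality (D : Delta R (nleaves t)) :
  even_pairing D (f_even (pure_tensor R B)) =
  even_tensor_pairing (g_even D) (pure_tensor R B).
Proof.
rewrite /even_tensor_pairing /tensor_pairing bilinear_extU.
rewrite /f_even liftU scale1r /even_pairing bilinear_extU.
(* Both sides are now linear extensions in [D], so comparing them on a single Diagram suffices. *)
rewrite /g_even fglift_comp; apply: (eq_fglift (M := R^o)) => d.
rewrite liftU scale1r (even_pair_g R vs_ordering).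
by apply: eq_bigr => v _; rewrite [in RHS]ffunE.
Qed.

Lemma odd_duality (D : oDelta R (nleaves t)) :
  odd_pairing D (f_odd vs (pure_tensor R B)) =
  odd_tensor_pairing (g_odd vs D) (pure_tensor R B).
Proof.
rewrite /odd_tensor_pairing /tensor_pairing bilinear_extU.
rewrite /f_odd liftU scale1r /odd_pairing bilinear_extZ.
rewrite /g_odd fglift_comp; apply: (eq_fglift (M := R^o)) => d.
rewrite fgliftZ liftU scale1r (odd_pair_g R vs_ordering).
by congr (_ * _); apply: eq_bigr => v _; rewrite [in RHS]ffunE.
Qed.

End TensorDuality.

Theorem theorem6p8 (R : comNzRingType) (t : rptree)
    (vs : seq (vertex t)) (vs_ordering : perm_eq vs (enum (vertex t)))
    (B : forall v : vertex t, bexpr (arity v)) :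
  (forall D : Delta R (nleaves t),
     even_pairing D (f_even (pure_tensor R B)) =
     even_tensor_pairing (g_even D) (pure_tensor R B)) /\
  (forall D : oDelta R (nleaves t),
     odd_pairing D (f_odd vs (pure_tensor R B)) =
     odd_tensor_pairing (g_odd vs D) (pure_tensor R B)).
Proof.
by split=> D; [apply: even_duality vs_ordering _ D | apply: odd_duality].
Qed.
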